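(* Let $E$ be a nonzero reflexive real Banach space and let $S\colon E\rightrightarrows E^*$ and $T\colon E^*\rightrightarrows E$ be maximally monotone. Suppose $\pi_1\,\mathrm{dom}\,\varphi_T=E^*$ and there exists $w^*\in E^*$ with $E\times\{w^*\}\subset\mathrm{dom}\,\varphi_S$. Then (a) $(I_E+TS)(E)=E$, where $I_E$ is the identity of $E$; (b) $(I_{E^*}+ST)(E^* )=E^*$, where $I_{E^*}$ is the identity of $E^*$.
   Context: Since $E$ is reflexive, $T$ is regarded as a multifunction from $E^*$ into $E=E^{**}$, with graph $G(T)\subset E^*\times E$; monotonicity of $T$ means $\langle t_1-t_2,t_1^*-t_2^*\rangle\ge0$ for $(t_1^*,t_1),(t_2^*,t_2)\in G(T)$. Fitzpatrick functions: $\varphi_S(x,x^* ):=\sup_{(s,s^* )\in G(S)}[\langle x,s^*\rangle+\langle s,x^*\rangle-\langle s,s^*\rangle]$ on $E\times E^*$, and $\varphi_T(x^*,x):=\sup_{(t^*,t)\in G(T)}[\langle x,t^*\rangle+\langle t,x^*\rangle-\langle t,t^*\rangle]$ on $E^*\times E$; $\mathrm{dom}$ denotes the set where the function is finite, and $\pi_1$ is projection on the first coordinate. $TSx:=\bigcup_{y^*\in Sx}Ty^*$, $STx^*:=\bigcup_{y\in Tx^*}Sy$, $(I_E+TS)x:=\{x+z\colon z\in TSx\}$, and images of sets are unions of images of points. *)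

(* Defs.v *)
From HB Require Import structures.
From mathcomp Require Import all_boot all_order all_algebra.
From mathcomp Require Import all_classical all_reals all_analysis.
Set Implicit Arguments. Unset Strict Implicit. Unset Printing Implicit Defensive.
Import Order.TTheory GRing.Theory Num.Theory.
Import numFieldNormedType.Exports.
Local Open Scope classical_set_scope.
Local Open Scope ring_scope.

Section Dual.
Variables (R : realType) (E : normedModType R).

Definition is_dual (f : E -> R) : Prop :=
  (forall (a : R) (x y : E), f (a *: x + y) = a * f x + f y) /\ continuous f.

Definition dual_norm (f : E -> R) : R :=
  sup [set y : R | exists2 x : E, `|x| <= 1 & y = `|f x|].

Definition is_bidual (Phi : (E -> R) -> R) : Prop :=
  (forall (a : R) (f g : E -> R), is_dual f -> is_dual g ->
      Phi (fun x => a * f x + g x) = a * Phi f + Phi g) /\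
  exists C : R, forall f, is_dual f -> `|Phi f| <= C * dual_norm f.

Definition reflexive_space : Prop :=
  forall Phi, is_bidual Phi -> exists x : E, forall f, is_dual f -> Phi f = f x.

Definition maximally_monotone_S (S : E -> set (E -> R)) : Prop :=
  (forall x xs, S x xs -> is_dual xs) /\
  (forall x1 xs1 x2 xs2, S x1 xs1 -> S x2 xs2 ->
      0 <= xs1 (x1 - x2) - xs2 (x1 - x2)) /\
  (forall x xs, is_dual xs ->
      (forall s ss, S s ss -> 0 <= xs (x - s) - ss (x - s)) -> S x xs).

(* T : E^* ⇉ E (identified with its bidual), given by its graph T t^* t *)
Definition maximally_monotone_T (T : (E -> R) -> set E) : Prop :=
  (forall ts t, T ts t -> is_dual ts) /\
  (forall ts1 t1 ts2 t2, T ts1 t1 -> T ts2 t2 ->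
      0 <= ts1 (t1 - t2) - ts2 (t1 - t2)) /\
  (forall xs x, is_dual xs ->
      (forall ts t, T ts t -> 0 <= xs (x - t) - ts (x - t)) -> T xs x).

Definition fitz_S (S : E -> set (E -> R)) (x : E) (xs : E -> R) : \bar R :=
  ereal_sup [set v : \bar R | exists s ss, S s ss /\
                v = (ss x + xs s - ss s)%:E].

Definition fitz_T (T : (E -> R) -> set E) (xs : E -> R) (x : E) : \bar R :=
  ereal_sup [set v : \bar R | exists ts t, T ts t /\
                v = (ts x + xs t - ts t)%:E].
End Dual.

(* Main.v *)
Require Import Defs.
From HB Require Import structures.
From mathcomp Require Import all_boot all_order all_algebra.
From mathcomp Require Import all_classical all_reals all_analysis.
From mathcomp Require Import ring lra.
Import Order.TTheory GRing.Theory Num.Theory.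
Import numFieldNormedType.Exports.
Local Open Scope classical_set_scope.
Local Open Scope ring_scope.

(** Both parts reduce, by translating or reflecting T, to finding (y, y^* ) in
    G(S) with (y^*, -y) in G(T).  By maximality it is enough that
    phi_S(y, y^* ) + phi_T(y^*, -y) <= 0, that is, for all (s, s^* ) in G(S) and
    (t^*, t) in G(T),
      <y, s^* - t^*> + <s + t, y^*> <= <s, s^*> + <t, t^*>.
    Such a pair is a continuous linear minorant on E x E^* (E is reflexive) of
    the convex set N of all (x + u, x^* - u^*, r + q) with (x, x^*, r) and
    (u, u^*, q) in the epigraphs of the conjugates of phi_S and phi_T.  On these
    epigraphs r >= <x, x^*> and q >= <u, u^*>, so r + q is at least
    <a, x^*> + <x, b^*> - <a, b^*> with a = x + u, b^* = x^* - u^*.  The domain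
    conditions bound <z, x^*> + <x, z^*> from above, for every (z, z^* ), on the
    part of N where a, b^* are bounded and r + q <= 0; the uniform boundedness
    principle on E and on E^* then bounds x and x^*, whence
    r + q >= - K (|a| + |b^*|), and the Hahn-Banach theorem applies. *)

(** * Positive cones and the Hahn-Banach theorem *)

Definition positive_cone {R : realType} {V : lmodType R} (A : set (V * R)) : Prop :=
  [/\ forall x y c d, A (x, c) -> A (y, d) -> A (x + y, c + d),
      forall t x c, 0 < t -> A (x, c) -> A (t *: x, t * c),
      A (0, 0) & forall c, A (0, c) -> 0 <= c].

Section HahnBanach.
Context {R : realType} {V : lmodType R}.
Implicit Types A B : set (V * R).

(** Each condition involves at most two points, and a chain puts these in a single cone. Joining [A]
    makes the union of the empty chain a cone as well. *)
Lemma positive_cone_bigcup A : positive_cone A ->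
  forall F : set (set (V * R)), F `<=` [set X | positive_cone (A `|` X)] ->
  total_on F subset -> positive_cone (A `|` \bigcup_(X in F) X).
Proof.
move=> cA F FA totF.
have up p q : (A `|` \bigcup_(X in F) X) p -> (A `|` \bigcup_(X in F) X) q ->
    exists B, [/\ positive_cone B, B p, B q &
                  B `<=` A `|` \bigcup_(X in F) X].
  have sub X : F X -> A `|` X `<=` A `|` \bigcup_(X in F) X.
    by move=> FX z [Az|Xz]; [left|right; exists X].
  move=> [Ap|[X FX Xp]] [Aq|[Y FY Yq]].
  - by exists A; split => // z Az; left.
  - by exists (A `|` Y); split; [exact: FA|left|right|exact: sub].
  - by exists (A `|` X); split; [exact: FA|right|left|exact: sub].
  - have [XY|YX] := totF _ _ FX FY.
    + by exists (A `|` Y); split; [exact: FA|right; exact: XY|right|exact: sub].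
    + by exists (A `|` X); split; [exact: FA|right|right; exact: YX|exact: sub].
split.
- move=> x y c d p q; have [B [[addB _ _ _] Bp Bq]] := up _ _ p q.
  by apply; exact: addB.
- move=> t x c t0 p; have [B [[_ sclB _ _] Bp _]] := up _ _ p p.
  by apply; exact: sclB.
- by left; case: cA.
- by move=> c p; have [B [[_ _ _ posB] Bp _ _]] := up _ _ p p; exact: posB.
Qed.

Lemma maximal_positive_cone A : positive_cone A ->
  exists B, [/\ positive_cone B, A `<=` B &
    forall C, positive_cone C -> B `<=` C -> C `<=` B].
Proof.
move=> cA; have [M [cM maxM]] := Zorn_bigcup (positive_cone_bigcup A cA).
exists (A `|` M); split => // C cC BC.
have AC : A `|` C = C by apply/setUidPr => z Az; apply: BC; left.
apply: contrapT => nCB; apply: (maxM C); last by rewrite /= AC.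
split=> [z Mz|CM]; first by apply: BC; right.
by apply: nCB => z Cz; right; exact: CM.
Qed.

(** Adjoining the ray of [(y, c)] to [B] keeps positivity: a point above 0 that uses the multiple
    [t > 0] comes, after division by [t], from some [(- y, v)] in [B], where the hypothesis applies.
    Maximality then puts [(y, c)] in [B]. *)
Lemma maximal_positive_coneP B y c : positive_cone B ->
  (forall C, positive_cone C -> B `<=` C -> C `<=` B) ->
  (forall v, B (- y, v) -> 0 <= v + c) -> B (y, c).
Proof.
move=> [addB sclB B0 posB] maxB Byc.
pose C := [set p : V * R | exists2 t, 0 <= t & B (p.1 - t *: y, p.2 - t * c)].
apply: (maxB C); last by exists 1 => //=; rewrite scale1r mul1r !subrr.
  split=> [x z a b [t t0 /= Bt] [u u0 /= Bu]|t x a t0 [u u0 /= Bu]||a [t]].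
  - exists (t + u); first exact: addr_ge0.
    by rewrite /= scalerDl mulrDl !opprD !(addrACA _ _ (- _)); exact: addB.
  - exists (t * u); first by rewrite mulr_ge0// ltW.
    by rewrite /= -scalerA -scalerBr -mulrA -mulrBr; exact: sclB.
  - by exists 0 => //=; rewrite scale0r mul0r !subr0.
  - rewrite le_eqVlt => /orP[/eqP <-|t0] /=.
      by rewrite scale0r mul0r !subr0; exact: posB.
    rewrite sub0r => /(sclB t^-1 _ _ _); rewrite invr_gt0 t0 => /(_ isT).
    rewrite scalerN scalerA mulVf ?gt_eqF// scale1r => /Byc.
    by rewrite mulrBr mulKf ?gt_eqF// subrK pmulr_rge0 ?invr_gt0.
by move=> [x a] Bx; exists 0 => //=; rewrite scale0r mul0r !subr0.
Qed.

(* Applied to the epigraph of a sublinear functional, this is the Hahn-Banach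
   theorem.  A maximal positive cone is the epigraph of a linear functional. *)
Lemma positive_cone_minorant A : positive_cone A ->
  (forall x, exists c, A (x, c)) ->
  exists L : V -> R, (forall a x y, L (a *: x + y) = a * L x + L y) /\
    forall x c, A (x, c) -> L x <= c.
Proof.
move=> /maximal_positive_cone[B [cB AB maxB]] totA.
have totB x : exists c, B (x, c) by have [c /AB] := totA x; exists c.
have maxBP := maximal_positive_coneP _ _ _ cB maxB.
have [addB sclB _ posB] := cB.
(* The infimum is finite: fibres of [B] are nonempty, and a point above [- x] bounds the fibre above
   [x] from below. *)
pose L x := inf [set c | B (x, c)].
have LB x v : B (- x, v) -> lbound [set c | B (x, c)] (- v).
  by move=> Bv c /= Bc; have := addB _ _ _ _ Bv Bc; rewrite addNr => /posB; lra.
have L_le x c : B (x, c) -> L x <= c.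
  move=> Bc; apply: ge_inf => //; have [v Bv] := totB (- x).
  by exists (- v); exact: LB.
have L_ge x v : B (- x, v) -> - v <= L x.
  by move=> Bv; apply: lb_le_inf; [have [c] := totB x; exists c|exact: LB].
(* Maximality enters here. It makes [L] odd and its infimum attained, so that subadditivity, used at
   a pair and at its negative, becomes additivity. *)
have BL x : B (x, - L (- x)).
  by apply: maxBP => v Bv; rewrite subr_ge0; exact: L_le.
have LN x : L (- x) = - L x.
  apply/eqP; rewrite eq_le; apply/andP; split.
    by rewrite lerNr; exact: L_le.
  by apply: lb_le_inf; [have [c] := totB (- x); exists c|move=> v /L_ge; lra].
have {}BL x : B (x, L x) by have := BL x; rewrite LN opprK.
have LD x y : L (x + y) = L x + L y.
  apply/eqP; rewrite eq_le L_le/=; last exact: addB.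
  rewrite -lerN2 opprD -!LN opprD; apply: L_le; exact: addB.
have LZp t x : 0 < t -> L (t *: x) = t * L x.
  move=> t0; apply/eqP; rewrite eq_le L_le/=; last exact: sclB.
  rewrite -lerN2 -mulrN -!LN -scalerN; apply: L_le; exact: sclB.
have L0 : L 0 = 0 by have := LD 0 0; rewrite addr0; lra.
exists L; split=> [a x y|x c /AB]; last exact: L_le.
rewrite LD; congr (_ + _); have [a0|a0|->] := ltgtP a 0.
- have := LZp (- a) x; rewrite oppr_gt0 scaleNr LN => /(_ a0); lra.
- exact: LZp.
- by rewrite scale0r mul0r.
Qed.

End HahnBanach.

(** * Continuous linear functionals and the dual norm *)

Section DualSpace.
Context {R : realType} {E : normedModType R}.
Implicit Types (f g : E -> R) (x y : E).

Lemma is_dualD f x y : is_dual f -> f (x + y) = f x + f y.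
Proof. by move=> [lf _]; have := lf 1 x y; rewrite scale1r mul1r. Qed.

Lemma is_dual0 f : is_dual f -> f 0 = 0.
Proof. by move=> df; have := is_dualD f 0 0 df; rewrite addr0; lra. Qed.

Lemma is_dualZ f a x : is_dual f -> f (a *: x) = a * f x.
Proof. by move=> df; have := df.1 a x 0; rewrite addr0 is_dual0// addr0. Qed.

Lemma is_dualN f x : is_dual f -> f (- x) = - f x.
Proof. by move=> df; rewrite -scaleN1r is_dualZ// mulN1r. Qed.

Lemma is_dualB f x y : is_dual f -> f (x - y) = f x - f y.
Proof. by move=> df; rewrite is_dualD// is_dualN. Qed.

Lemma bounded_is_dual f (K : R) :
  (forall a x y, f (a *: x + y) = a * f x + f y) ->
  (forall x, `|f x| <= K * `|x|) -> is_dual f.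
Proof.
move=> lf fK; split=> //; pose F : {linear E -> R^o} :=
  HB.pack (f : E -> R^o) (GRing.isLinear.Build _ _ _ _ (f : E -> R^o) lf).
apply: (@bounded_linear_continuous _ _ _ F).
apply/bounded_funP => r; exists (`|K| * r) => x xr; apply: le_trans (fK x) _.
by apply: le_trans (ler_wpM2r _ (ler_norm K)) _ => //; exact: ler_wpM2l.
Qed.

Lemma is_dual_bounded f : is_dual f ->
  exists2 K, 0 <= K & forall x, `|f x| <= K * `|x|.
Proof.
move=> [lf cf]; pose F : {linear E -> R^o} :=
  HB.pack (f : E -> R^o) (GRing.isLinear.Build _ _ _ _ (f : E -> R^o) lf).
have /linear_boundedP/pinfty_ex_gt0[K K0 fK] : bounded_near F (nbhs (0 : E)).
  exact/linear_bounded_continuous.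
by exists K; first exact: ltW.
Qed.

Lemma is_dual_lin f g (a : R) :
  is_dual f -> is_dual g -> is_dual (fun x => a * f x + g x).
Proof.
move=> df dg; have [K _ fK] := is_dual_bounded f df.
have [M _ gM] := is_dual_bounded g dg.
apply: (@bounded_is_dual _ (`|a| * K + M)) => [b x y|x].
  by rewrite df.1 dg.1; ring.
rewrite mulrDl -mulrA (le_trans (ler_normD _ _))// normrM lerD//.
by rewrite ler_wpM2l.
Qed.

Lemma is_dual_zero : is_dual (fun _ : E => 0 : R).
Proof.
by apply: (@bounded_is_dual _ 0) => [a x y|x]; rewrite ?mulr0 ?addr0// normr0 mul0r.
Qed.

Lemma dual_norm_has_sup f : is_dual f ->
  has_sup [set y : R | exists2 x : E, `|x| <= 1 & y = `|f x|].
Proof.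
move=> df; split; first by exists `|f 0|, 0; rewrite ?normr0.
have [K K0 fK] := is_dual_bounded f df; exists K => _ [x x1 ->].
by apply: le_trans (fK x) _; rewrite ler_piMr.
Qed.

Lemma le_dual_norm f x : is_dual f -> `|f x| <= dual_norm f * `|x|.
Proof.
move=> df; have [->|x0] := eqVneq x 0; first by rewrite is_dual0// !normr0 mulr0.
rewrite -ler_pdivrMr ?normr_gt0//; apply: ub_le_sup.
  by have [] := dual_norm_has_sup f df.
exists (`|x|^-1 *: x).
  by rewrite normrZ normfV normr_id mulVf// normr_eq0.
by rewrite is_dualZ// normrM normfV normr_id mulrC.
Qed.

Lemma dual_norm_le f (K : R) :
  (forall x, `|x| <= 1 -> `|f x| <= K) -> dual_norm f <= K.
Proof.
move=> fK; apply: ge_sup => [|_ [x x1 ->]]; last exact: fK.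
by exists `|f 0|, 0; rewrite ?normr0.
Qed.

Lemma dual_norm_ge0 f : is_dual f -> 0 <= dual_norm f.
Proof.
move=> df; apply: le_trans (normr_ge0 (f 0)) _; apply: ub_le_sup.
  by have [] := dual_norm_has_sup f df.
by exists 0; rewrite ?normr0.
Qed.

Lemma dual_norm_lin f g (a : R) : is_dual f -> is_dual g ->
  dual_norm (fun x => a * f x + g x) <= `|a| * dual_norm f + dual_norm g.
Proof.
move=> df dg; apply: dual_norm_le => x x1.
rewrite (le_trans (ler_normD _ _))// normrM; apply: lerD.
  rewrite ler_wpM2l// (le_trans (le_dual_norm f x df))//.
  by rewrite ler_piMr// dual_norm_ge0.
rewrite (le_trans (le_dual_norm g x dg))//.
by rewrite ler_piMr// dual_norm_ge0.
Qed.

(** The epigraph of the norm together with the ray of [(- x, - |x|)] generates a positive cone; a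
    linear minorant [f] of it satisfies [f (- x) <= - |x|]. *)
Lemma norming_functional x :
  exists f, [/\ is_dual f, forall y, `|f y| <= `|y| & f x = `|x|].
Proof.
pose A := [set p : E * R | exists2 t, 0 <= t & `|p.1 + t *: x| - t * `|x| <= p.2].
have [] := @positive_cone_minorant _ E A.
- split=> [y z c d [t t0 /= tc] [u u0 /= ud]|t y c t0 [u u0 /= uc]||c [t t0 /=]].
  + exists (t + u) => /=; first exact: addr_ge0.
    rewrite scalerDl addrACA mulrDl opprD.
    by have := ler_normD (y + t *: x) (z + u *: x); lra.
  + exists (t * u); first by rewrite mulr_ge0// ltW.
    by rewrite /= -scalerA -scalerDr normrZ gtr0_norm// -mulrA -mulrBr ler_pM2l.
  + by exists 0 => //=; rewrite scale0r mul0r subr0 addr0 normr0.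
  + by rewrite add0r normrZ ger0_norm// subrr.
- by move=> y; exists `|y|, 0 => //=; rewrite scale0r mul0r subr0 addr0.
move=> f [lf fA].
have f_le y : f y <= `|y|.
  by apply: fA; exists 0 => //=; rewrite scale0r mul0r subr0 addr0.
have fN y : f (- y) = - f y.
  have f00 := lf 1 0 0; have := lf (-1) y 0.
  by rewrite scale1r addr0 in f00; rewrite scaleN1r addr0; lra.
have f_norm y : `|f y| <= `|y|.
  by rewrite ler_norml f_le lerNl -fN -(normrN y) f_le.
exists f; split=> //; first by apply: (@bounded_is_dual _ 1) => // y; rewrite mul1r.
apply/eqP; rewrite eq_le f_le/= -lerN2 -fN; apply: fA; exists 1 => //=.
by rewrite scale1r addNr normr0 mul1r sub0r.
Qed.

End DualSpace.

(** * The dual as a vector space *)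

Section DualLmodule.
Variables (R : realType) (E : normedModType R).

Definition dual_pred : {pred (E -> R^o)} := fun f => `[< is_dual (f : E -> R) >].

Lemma dual_submod_closed : submod_closed dual_pred.
Proof.
split=> [|a f g /asboolP df /asboolP dg]; apply/asboolP.
  exact: is_dual_zero.
exact: is_dual_lin.
Qed.

HB.instance Definition _ :=
  GRing.isSubmodClosed.Build R (E -> R^o) dual_pred dual_submod_closed.

(** The subtype makes [E * dual] a vector space, in which the separation below takes place; size is
    still measured by [dual_norm]. *)
Definition dual := {f : E -> R^o | f \in dual_pred}.
HB.instance Definition _ := SubChoice.on dual.
HB.instance Definition _ := [SubChoice_isSubLmodule of dual by <:].

Definition dual_fun (f : dual) : E -> R := val f.

Lemma dual_funP f : is_dual (dual_fun f).
Proof. exact/asboolP/(valP f). Qed.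

Definition to_dual (f : E -> R) (df : is_dual f) : dual :=
  exist _ (f : E -> R^o) (introT (asboolP _) df).

Lemma to_dualK f df : dual_fun (@to_dual f df) = f.
Proof. by []. Qed.

Lemma dual_funD f g : dual_fun (f + g) = fun x => dual_fun f x + dual_fun g x.
Proof. by []. Qed.

Lemma dual_funZ a f : dual_fun (a *: f) = fun x => a * dual_fun f x.
Proof. by []. Qed.

Lemma dual_fun_inj f g : (forall x, dual_fun f x = dual_fun g x) -> f = g.
Proof. by move=> fg; apply/val_inj/funext => x; exact: fg. Qed.

End DualLmodule.

(** * Weakly bounded sets are bounded *)

Section UniformBoundedness.
Context {R : realType} {E : normedModType R}.

(** With ratio 1/3 the sum of [e k] over [k > n] is [e n / 2], so later increments undo at most half
    of the [n]-th. *)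
Let e n : R := 3^-1 ^+ n.

Let e_gt0 n : 0 < e n. Proof. by rewrite exprn_gt0 ?invr_gt0. Qed.

Let eS n : 3 * e n.+1 = e n.
Proof. by rewrite /e exprS mulrA divff ?mul1r ?pnatr_eq0. Qed.

Let le0_geometric (z C : R) : (forall n, z <= C * e n) -> z <= 0.
Proof.
move=> zC; rewrite leNgt; apply/negP => z0.
pose n := Num.bound (C / z).
have n3 : (n%:R : R) <= 3 ^+ n by rewrite -natrX ler_nat ltnW// ltn_expl.
have Cn : C / z < n%:R.
  exact: unstable.ltr_bound.
have := zC n; apply/negP; rewrite -ltNge /e exprVn ltr_pdivrMr ?exprn_gt0//.
by rewrite mulrC -ltr_pdivrMr//; exact: lt_le_trans Cn n3.
Qed.

(** Nested intervals: [u x] increases, [v x] decreases, and the limit lies between them. The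
    half-width is the sum of the increment bounds from the [n]-th on, so the error estimate comes
    with the limit. *)
Lemma is_dual_geometric_limit (f : nat -> E -> R) :
  (forall n, is_dual (f n)) ->
  (forall n x, `|f n.+1 x - f n x| <= e n * `|x|) ->
  exists F, is_dual F /\
    forall n x, `|F x - f n x| <= 3 / 2 * e n * `|x|.
Proof.
move=> df fe.
pose u x n := f n x - 3 / 2 * e n * `|x|.
pose v x n := f n x + 3 / 2 * e n * `|x|.
have step x n : `|f n.+1 x - f n x| <= 3 * e n.+1 * `|x| by rewrite eS.
have u_incr x : {homo u x : n m / (n <= m)%N >-> n <= m}.
  apply: homo_leq; [exact: lexx|exact: le_trans|move=> n].
  by have := step x n; rewrite ler_norml /u -(eS n) => /andP[]; lra.
have v_decr x : {homo v x : n m / (n <= m)%N >-> m <= n}.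
  apply: (@homo_leq _ _ (fun a b => b <= a)); [exact: lexx| |move=> n].
    by move=> a b c ab bc; exact: le_trans bc ab.
  by have := step x n; rewrite ler_norml /v -(eS n) => /andP[]; lra.
have uv x n m : u x n <= v x m.
  apply: (@le_trans _ _ (u x (maxn n m))); first exact/u_incr/leq_maxl.
  apply: (@le_trans _ _ (v x (maxn n m))); last exact/v_decr/leq_maxr.
  have : 0 <= e (maxn n m) * `|x| by rewrite mulr_ge0// ltW.
  by rewrite /u /v; lra.
pose F x := sup (range (u x)).
have uF x n : u x n <= F x.
  by apply: ub_le_sup; [exists (v x 0%N) => _ [m _ <-]|exists n].
have Fv x n : F x <= v x n.
  by apply: ge_sup => [|_ [m _ <-]]; [exists (u x 0%N), 0%N|exact: uv].
have Ff n x : `|F x - f n x| <= 3 / 2 * e n * `|x|.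
  by have := uF x n; have := Fv x n; rewrite /u /v ler_norml; lra.
exists F; split => //; have [K _ f0K] := is_dual_bounded _ (df 0%N).
apply: (bounded_is_dual _ (K + 3 / 2)) => [a x y|x]; last first.
  have := ler_normD (F x - f 0%N x) (f 0%N x); rewrite subrK.
  by have := f0K x; have := Ff 0%N x; rewrite /e expr0; lra.
(* Each [f n] is linear, so the linearity defect of [F] is of order [e n] for every [n]. *)
apply/eqP; rewrite -subr_eq0 -normr_le0.
apply: (@le0_geometric _ (3 / 2 * (`|a *: x + y| + `|a| * `|x| + `|y|))) => n.
have -> : F (a *: x + y) - (a * F x + F y) =
    (F (a *: x + y) - f n (a *: x + y)) + - (a * (F x - f n x)) + - (F y - f n y).
  by rewrite (df n).1; ring.
rewrite (le_trans (ler_normD _ _))//.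
have := ler_normD (F (a *: x + y) - f n (a *: x + y)) (- (a * (F x - f n x))).
rewrite !normrN normrM => h1.
have h2 := Ff n (a *: x + y); have h3 := Ff n y.
have h4 : `|a| * `|F x - f n x| <= `|a| * (3 / 2 * e n * `|x|).
  by rewrite ler_wpM2l.
by lra.
Qed.

(* Gliding hump; the sign makes the n-th increment add up with the previous
   terms at [a n]. *)
Lemma weakly_bounded_bounded (A : set E) :
  (forall f, is_dual f -> exists C, forall x, A x -> f x <= C) ->
  exists K, forall x, A x -> `|x| <= K.
Proof.
move=> wA; apply: contrapT => unbA.
(* The factor 2 allows for the half of the [n]-th increment that later ones may cancel. *)
have /choice[a aP] n : exists x, A x /\ 2 * n%:R < e n * `|x|.
  apply: contrapT => nx; apply: unbA; exists (2 * n%:R / e n) => x Ax.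
  rewrite leNgt ltr_pdivrMr// [_ * e n]mulrC; apply/negP => ?.
  by apply: nx; exists x.
have /choice[g gP] n := norming_functional (a n).
pose s (f : E -> R) n : R := if 0 <= f (a n) then e n else - e n.
pose f := fix f n : E -> R :=
  if n is m.+1 then fun x => s (f m) m * g m x + f m x else fun=> 0.
have df n : is_dual (f n).
  elim: n => [|n IH]; first exact: is_dual_zero.
  by have [dg _ _] := gP n; exact: is_dual_lin.
have ns n : `|s (f n) n| = e n.
  by rewrite /s; case: ifP => _; rewrite ?normrN gtr0_norm.
have [|F [dF Ff]] := is_dual_geometric_limit f df.
  move=> n x; rewrite /= addrK normrM ns; have [_ gx _] := gP n.
  by rewrite ler_wpM2l// ltW.
have [C FC] := wA F dF.
have [D FD] : exists D, forall x, A x -> - F x <= D.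
  have [] := wA (fun x => -1 * F x + 0).
    exact: (is_dual_lin _ _ _ dF is_dual_zero).
  by move=> D FD; exists D => x /FD; lra.
pose n := Num.bound (`|C| + `|D|).
have nCD : `|C| + `|D| < n%:R := unstable.ltr_bound _.
have [an big] := aP n.
(* Later increments change the value at [a n] by at most half of [e n * |a n|]; hence
   [|F (a n)| > n], against the choice of [n]. *)
have := Ff n.+1 (a n); have -> : 3 / 2 * e n.+1 = e n / 2 by rewrite -(eS n); lra.
have : e n * `|a n| <= `|f n.+1 (a n)|.
  have [_ _ gn] := gP n; have p0 : 0 <= e n * `|a n| by rewrite mulr_ge0// ltW.
  have -> : f n.+1 (a n) = s (f n) n * g n (a n) + f n (a n) by [].
  rewrite gn /s; move: (f n (a n)) => c; case: (leP 0 c) => c0.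
    by rewrite ger0_norm ?lerDl// addr_ge0.
  by rewrite ltr0_norm; lra.
have := ler_normB (F (a n)) (F (a n) - f n.+1 (a n)); rewrite opprB addrCA subrr addr0.
have : `|F (a n)| <= `|C| + `|D|.
  have := FC _ an; have := FD _ an; have := ler_norm C; have := ler_norm D.
  have := normr_ge0 C; have := normr_ge0 D.
  by rewrite ler_norml; lra.
by lra.
Qed.

End UniformBoundedness.

(** * Linear minorants of convex sets *)

Section ConvexMinorant.
Context {R : realType} {V : lmodType R}.

(* The lower bound on [N] is only needed on a ball; the cone of the proof is
   total because the radius of that ball exceeds [d w0]. *)
Lemma convex_minorant (d : V -> R) (N : set (V * R)) (w0 : V) (r0 K : R) :
  (forall x y, d (x + y) <= d x + d y) ->
  (forall a x, d (a *: x) = `|a| * d x) ->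
  (forall a b x y r s, 0 <= a -> 0 <= b -> a + b = 1 -> N (x, r) -> N (y, s) ->
    N (a *: x + b *: y, a * r + b * s)) ->
  N (w0, r0) -> 0 <= K ->
  (forall x r, N (x, r) -> d x <= d w0 + 1 -> - (K * d x) <= r) ->
  exists L : V -> R, [/\ forall a x y, L (a *: x + y) = a * L x + L y,
    forall x r, N (x, r) -> L x <= r &
    exists C, forall x, `|L x| <= C * d x].
Proof.
move=> dD dZ cN Nw0 K0 lbN.
have d0 : d 0 = 0 by rewrite -(scale0r w0) dZ normr0 mul0r.
have dN x : d (- x) = d x by rewrite -scaleN1r dZ normrN1 mul1r.
have d_ge0 x : 0 <= d x by have := dD x (- x); rewrite subrr d0 dN; lra.
set rho := d w0 + 1.
(* The cone over [N], thickened by balls of radius [rho] at cost [K * d]. Above 0 and for [t > 0],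
   the radius constraint forces [d x <= rho], where [lbN] applies. *)
pose A := [set p : V * R | exists t x r, [/\ 0 <= t, N (x, r),
  d (p.1 - t *: x) <= rho * t & t * r + K * d (p.1 - t *: x) <= p.2]].
have [||L [lL LA]] := @positive_cone_minorant _ V A.
- split.
  + move=> x y c e [t [x' [r [t0 Nx dx xc]]]] [u [y' [s [u0 Ny dy ye]]]].
    (* If [t = u = 0] there are no convex weights, but both radii vanish, so [d x = d y = 0]. *)
    have [tu0|tu0] := eqVneq (t + u) 0.
      have [t00 u00] : t = 0 /\ u = 0 by split; lra.
      subst t u; exists 0, x', r; move: dx dy xc ye; rewrite /= !scale0r !subr0.
      rewrite !mulr0 !mul0r !add0r => dx dy xc ye; have := dD x y.
      have -> : d x = 0 by have := d_ge0 x; lra.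
      have -> : d y = 0 by have := d_ge0 y; lra.
      rewrite addr0 => dxy; have -> : d (x + y) = 0 by have := d_ge0 (x + y); lra.
      split=> //; rewrite mulr0.
      by have := d_ge0 x; have := d_ge0 y; have := mulr_ge0 K0 (d_ge0 x);
         have := mulr_ge0 K0 (d_ge0 y); lra.
    exists (t + u), ((t / (t + u)) *: x' + (u / (t + u)) *: y'),
      (t / (t + u) * r + u / (t + u) * s).
    have eqw : x + y - (t + u) *: (t / (t + u) *: x' + u / (t + u) *: y') =
        (x - t *: x') + (y - u *: y').
      rewrite scalerDr !scalerA ![(t + u) * _]mulrC !divfK//.
      by rewrite opprD addrACA.
    have eqr : (t + u) * (t / (t + u) * r + u / (t + u) * s) = t * r + u * s.
      by field.
    rewrite /= eqw eqr; have dxy := dD (x - t *: x') (y - u *: y').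
    split; [exact: addr_ge0| | |].
    * apply: cN => //; rewrite ?divr_ge0 ?addr_ge0//.
      by rewrite -mulrDl divff.
    * by move: dx dy => /=; lra.
    * by have := ler_wpM2l K0 dxy; move: xc ye => /=; lra.
  + move=> t x c t0 [u [x' [r [u0 Nx /= dx xc]]]]; exists (t * u), x', r => /=.
    rewrite -scalerA -scalerBr dZ gtr0_norm//; split=> //.
    * by rewrite mulr_ge0// ltW.
    * by rewrite mulrCA ler_pM2l.
    * by rewrite mulrCA -mulrA -mulrDr ler_pM2l.
  + exists 0, w0, r0 => /=.
    by rewrite scale0r subr0 d0 mulr0 mul0r mulr0 addr0.
  + move=> c [t [x [r [t0 Nx /=]]]]; rewrite sub0r dN dZ ger0_norm// => dx.
    apply: le_trans; move: t0 dx; rewrite le_eqVlt => /orP[/eqP<-|t0].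
      by rewrite !mul0r !mulr0 addr0.
    rewrite mulrC ler_pM2r// => /(lbN _ _ Nx) lb.
    have -> : t * r + K * (d x * t) = t * (r + K * d x) by ring.
    by apply: mulr_ge0; [exact: ltW|lra].
- move=> x; pose t := d x + 1; exists (t * r0 + K * d (x - t *: w0)), t, w0, r0.
  have t0 : 0 <= t by rewrite addr_ge0.
  split=> //=; have := dD x (- (t *: w0)); rewrite dN dZ ger0_norm//.
  have -> : rho * t = t * d w0 + d x + 1 by rewrite /rho /t; ring.
  by lra.
exists L; split=> [//|x r Nx|].
  apply: LA; exists 1, x, r; rewrite /= scale1r subrr d0 !mulr1 mulr0 mul1r addr0.
  by split=> //; rewrite addr_ge0.
have L0 : L 0 = 0 by have := lL 1 0 0; rewrite scale1r mul1r addr0; lra.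
have LZ a x : L (a *: x) = a * L x by have := lL a x 0; rewrite !addr0 L0 addr0.
set C := `|r0| + K * rho.
have rho0 : 0 <= rho by rewrite addr_ge0.
have C0 : 0 <= C by rewrite addr_ge0// mulr_ge0.
(* Since [rho = d w0 + 1], the point [(w0, r0)] with [t = 1] is a witness on the whole unit ball of
   [d]. *)
have L1 x : d x <= 1 -> L x <= C.
  move=> dx; have dxw : d (x - w0) <= rho.
    by have := dD x (- w0); rewrite dN /rho; lra.
  apply: LA; exists 1, w0, r0; rewrite /= scale1r mulr1 mul1r; split=> //.
  by rewrite lerD ?ler_norm// ler_wpM2l.
have LC x : L x <= C * d x.
  (* [d] may vanish away from 0, so [x] is scaled by [d x + del] rather than by [d x]. *)
  apply/ler_addgt0Pr => eps eps0.
  pose del := eps / (C + 1); have C1 : 0 < C + 1 by rewrite ltr_wpDl.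
  have del0 : 0 < del by rewrite divr_gt0.
  have dd : 0 < d x + del by rewrite ltr_wpDl.
  have := L1 ((d x + del)^-1 *: x); rewrite dZ LZ normfV gtr0_norm//.
  rewrite !ler_pdivrMl// mulr1 lerDl ltW// => /(_ isT) /le_trans; apply.
  rewrite mulrDl [C * _]mulrC lerD2l.
  have -> : eps = (C + 1) * del by rewrite /del mulrC divfK// gt_eqF.
  by rewrite mulrC ler_pM2r// lerDl.
exists C => x; rewrite ler_norml LC andbT lerNl.
by rewrite -mulN1r -LZ scaleN1r -(dN x).
Qed.

End ConvexMinorant.

(** * Conjugates of Fitzpatrick functions of monotone graphs *)

Section MonotoneGraphs.
Context {R : realType} {E : normedModType R}.
Implicit Types (G : E -> set (E -> R)).

(* [fitz_le G y ys c] says that the Fitzpatrick function of G is at most c at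
   (y, ys), and [fitz_conj_le G] is the epigraph of its conjugate. *)
Definition fitz_le G (y : E) (ys : E -> R) (c : R) : Prop :=
  forall s ss, G s ss -> ss y + ys s - ss s <= c.

Definition fitz_conj_le G (x : E) (xs : E -> R) (r : R) : Prop :=
  is_dual xs /\ forall y ys c, is_dual ys -> fitz_le G y ys c ->
    xs y + ys x - r <= c.

Lemma fitz_conj_le_graph G s ss : is_dual ss -> G s ss ->
  fitz_conj_le G s ss (ss s).
Proof. by move=> dss Gs; split=> // y ys c _; apply. Qed.

Lemma fitz_conj_le_convex G a b x xs r y ys q :
  0 <= a -> 0 <= b -> a + b = 1 ->
  fitz_conj_le G x xs r -> fitz_conj_le G y ys q ->
  fitz_conj_le G (a *: x + b *: y) (fun e => a * xs e + b * ys e)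
    (a * r + b * q).
Proof.
move=> a0 b0 ab [dxs Hx] [dys Hy]; split.
  have := is_dual_lin xs _ a dxs (is_dual_lin ys _ b dys is_dual_zero).
  by under eq_fun do rewrite addr0.
move=> z zs c dzs zc; have := ler_wpM2l a0 (Hx z zs c dzs zc).
have := ler_wpM2l b0 (Hy z zs c dzs zc).
rewrite /= (is_dualD zs)// !(is_dualZ zs)//.
have : a * c + b * c = c by rewrite -mulrDl ab mul1r.
by lra.
Qed.

(** The conjugate inequality is used twice. At a graph point, where monotonicity bounds the
    Fitzpatrick function by [ss s], it shows that this function is at most [r] at [(x, xs)]; at
    [(x, xs)] it then gives [2 * xs x - r <= r]. *)
Lemma fitz_conj_le_ge G x xs r :
  (forall s ss, G s ss -> is_dual ss) ->
  (forall x1 xs1 x2 xs2, G x1 xs1 -> G x2 xs2 ->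
    0 <= xs1 (x1 - x2) - xs2 (x1 - x2)) ->
  fitz_conj_le G x xs r -> xs x <= r.
Proof.
move=> dG mG [dxs Hx].
have : xs x + xs x - r <= r.
  apply: (Hx) => // s ss Gs.
  have : xs s + ss x - r <= ss s.
    apply: Hx (dG _ _ Gs) _ => t ts Gt.
    have := mG _ _ _ _ Gt Gs.
    have dts := dG _ _ Gt; have dss := dG _ _ Gs.
    by rewrite (is_dualB ts)// (is_dualB ss)//; lra.
  by lra.
by lra.
Qed.

End MonotoneGraphs.

(** * A lower bound for the sum of the two conjugates *)

Section FitzpatrickSum.
Context {R : realType} {E : completeNormedModType R}.
Variables S T : E -> set (E -> R).
Hypothesis dS : forall s ss, S s ss -> is_dual ss.
Hypothesis mS : forall x1 xs1 x2 xs2, S x1 xs1 -> S x2 xs2 ->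
  0 <= xs1 (x1 - x2) - xs2 (x1 - x2).
Hypothesis dT : forall t ts, T t ts -> is_dual ts.
Hypothesis mT : forall x1 xs1 x2 xs2, T x1 xs1 -> T x2 xs2 ->
  0 <= xs1 (x1 - x2) - xs2 (x1 - x2).
Variable ws : E -> R.
Hypothesis dws : is_dual ws.
Hypothesis domS : forall x, exists c, fitz_le S x ws c.
Hypothesis domT : forall xs, is_dual xs -> exists p c, fitz_le T p xs c.

Let small rho x xs r y ys q := [/\ fitz_conj_le S x xs r, fitz_conj_le T y ys q,
  `|x + y| <= rho, dual_norm (fun e => -1 * ys e + xs e) <= rho & r + q <= 0].

(** Add the conjugate inequality of [S] at [(z, ws)] to that of [T] at [(p, vs)], then eliminate [y]
    and [ys] through [x + y] and [xs - ys], both bounded by [rho]. *)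
Let small_le rho vs p c : is_dual vs -> fitz_le T p vs c ->
  forall z, exists C, forall x xs r y ys q, small rho x xs r y ys q ->
    xs (z + p) + (ws x - vs x) <= C.
Proof.
move=> dvs Tc z; have [c' Sc'] := domS z.
exists (c + c' + rho * `|p| + dual_norm vs * rho).
move=> x xs r y ys q [[dxs Hx] [dys Hy] xy bxy rq].
have := Hx z ws c' dws Sc'; have := Hy p vs c dvs Tc.
have := le_trans (le_dual_norm _ p (is_dual_lin ys xs (-1) dys dxs))
  (ler_wpM2r (normr_ge0 p) bxy).
have := le_trans (le_dual_norm _ (x + y) dvs) (ler_wpM2l (dual_norm_ge0 _ dvs) xy).
rewrite !ler_norml (is_dualD vs)// (is_dualD xs)// => /andP[h1 h2] /andP[h3 h4].
by lra.
Qed.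

(** In [small_le], [vs = ws - f] and [z = - p] leave only [f x], so the points [x] are weakly
    bounded. Taking [vs = ws] leaves only [xs], evaluated at an arbitrary vector and its negative,
    so the [xs] are pointwise bounded. *)
Lemma fitz_sum_bounded rho : exists2 K, 0 <= K &
  forall x xs r y ys q, small rho x xs r y ys q ->
    `|x| <= K /\ dual_norm xs <= K.
Proof.
have [K1 xK1] : exists K, forall x,
    (exists xs r y ys q, small rho x xs r y ys q) -> `|x| <= K.
  apply: weakly_bounded_bounded => f df.
  have dvs := is_dual_lin f ws (-1) df dws.
  have [p [c Tc]] := domT _ dvs; have [C HC] := small_le rho _ _ _ dvs Tc (- p).
  exists C => x [xs [r [y [ys [q s]]]]]; have := HC _ _ _ _ _ _ s.
  by have [[dxs _] _ _ _ _] := s; rewrite addNr is_dual0//; lra.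
pose F := [set f : E -> R^o | exists x r y ys q, small rho x f r y ys q].
have [||M HM] := @Banach_Steinhauss R E R^o F _ _ 1.
- move=> f [x [r [y [ys [q [[df _] _ _ _ _]]]]]]; split; last by have [] := df.
  have [K K0 fK] := is_dual_bounded _ df => b; exists (K * b) => e eb.
  by apply: le_trans (fK e) _; rewrite ler_wpM2l.
- move=> z; have [p [c Tc]] := domT _ dws.
  have [C HC] := small_le rho _ _ _ dws Tc (z - p).
  have [D HD] := small_le rho _ _ _ dws Tc (- z - p).
  exists (`|C| + `|D|) => f [x [r [y [ys [q s]]]]].
  have := HC _ _ _ _ _ _ s; have := HD _ _ _ _ _ _ s.
  have [[df _] _ _ _ _] := s; rewrite !subrK subrr !addr0 is_dualN// => h1 h2.
  have := ler_norm C; have := ler_norm D; have := normr_ge0 C.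
  by have := normr_ge0 D; rewrite ler_norml; lra.
exists (`|K1| + `|M|) => [|x xs r y ys q s]; first by rewrite addr_ge0.
split.
  apply: le_trans (xK1 x _) _; first by exists xs, r, y, ys, q.
  by rewrite (le_trans (ler_norm _))// lerDl.
apply: dual_norm_le => e e1; apply: le_trans (HM _ _ e e1) _.
  by exists x, r, y, ys, q.
by rewrite (le_trans (ler_norm _))// lerDr.
Qed.

(** Only [r + q <= 0] is at stake. With [a = x + y] and [b = xs - ys],
    [xs x + ys y = xs a - b a + b x]; the three terms are at most [K * |a|], [|rho| * |b|] and
    [K * |b|] in absolute value. *)
Lemma fitz_sum_lower_bound rho : exists2 K, 0 <= K &
  forall x xs r y ys q, fitz_conj_le S x xs r -> fitz_conj_le T y ys q ->
    `|x + y| + dual_norm (fun e => -1 * ys e + xs e) <= rho ->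
    - (K * (`|x + y| + dual_norm (fun e => -1 * ys e + xs e))) <= r + q.
Proof.
have [K K0 HK] := fitz_sum_bounded rho.
exists (K + K + `|rho|) => [|x xs r y ys q Sx Ty]; first by rewrite !addr_ge0.
have [dxs _] := Sx; have [dys _] := Ty.
set b := fun e => _; have db : is_dual b by exact: is_dual_lin.
have b0 := dual_norm_ge0 _ db; have xy0 := normr_ge0 (x + y) => small_xy.
have [rq|/ltW rq] := leP (r + q) 0; last first.
  by apply: le_trans rq; rewrite oppr_le0 mulr_ge0 ?addr_ge0.
have [|xK xsK] := HK x xs r y ys q.
  by split=> //; lra.
have := fitz_conj_le_ge _ _ _ _ dS mS Sx; have := fitz_conj_le_ge _ _ _ _ dT mT Ty.
have : xs (x + y) - b (x + y) + b x = ys y + xs x.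
  by rewrite /b (is_dualD xs)// (is_dualD ys)//; ring.
have := le_trans (le_dual_norm _ (x + y) dxs) (ler_wpM2r xy0 xsK).
have := le_trans (le_dual_norm _ x db) (ler_wpM2l b0 xK).
have rho_xy : `|x + y| <= `|rho| by have := ler_norm rho; lra.
have := le_trans (le_dual_norm _ (x + y) db) (ler_wpM2l b0 rho_xy).
have := mulr_ge0 K0 xy0; have := mulr_ge0 K0 b0.
have := mulr_ge0 (normr_ge0 rho) xy0.
by rewrite !ler_norml => ? ? ? /andP[? ?] /andP[? ?] /andP[? ?]; lra.
Qed.

End FitzpatrickSum.

(** * Separation in the product of the space and its dual *)

Section Separation.
Context {R : realType} {E : completeNormedModType R}.
Hypothesis reflE : reflexive_space E.

Lemma bounded_functional_dual (L : dual R E -> R) (C : R) :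
  (forall a f g, L (a *: f + g) = a * L f + L g) ->
  (forall f, `|L f| <= C * dual_norm (dual_fun _ _ f)) ->
  exists y : E, forall f, L f = dual_fun _ _ f y.
Proof.
move=> lL LC.
(* Reflexivity concerns functionals on all functions, so [L] is extended by 0 off the dual, where
   [is_bidual] does not test it. *)
pose Phi (f : E -> R) : R :=
  if pselect (is_dual f) is left df then L (to_dual _ _ f df) else 0.
have PhiE f : Phi (dual_fun _ _ f) = L f.
  rewrite /Phi; case: pselect => [df|]; last by have := dual_funP _ _ f.
  by congr L; exact: dual_fun_inj.
have [|y Hy] := reflE Phi.
  split=> [a f g df dg|].
    have := PhiE (a *: to_dual _ _ f df + to_dual _ _ g dg).
    rewrite lL -!PhiE !to_dualK => <-; congr Phi.
  exists C => f df; have := LC (to_dual _ _ f df).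
  by rewrite -PhiE to_dualK.
by exists y => f; rewrite -PhiE Hy//; exact: dual_funP.
Qed.

Variables S T : E -> set (E -> R).
Hypothesis dS : forall s ss, S s ss -> is_dual ss.
Hypothesis mS : forall x1 xs1 x2 xs2, S x1 xs1 -> S x2 xs2 ->
  0 <= xs1 (x1 - x2) - xs2 (x1 - x2).
Hypothesis dT : forall t ts, T t ts -> is_dual ts.
Hypothesis mT : forall x1 xs1 x2 xs2, T x1 xs1 -> T x2 xs2 ->
  0 <= xs1 (x1 - x2) - xs2 (x1 - x2).
Hypothesis S0 : exists s ss, S s ss.
Hypothesis T0 : exists t ts, T t ts.
Variable ws : E -> R.
Hypothesis dws : is_dual ws.
Hypothesis domS : forall x, exists c, fitz_le S x ws c.
Hypothesis domT : forall xs, is_dual xs -> exists p c, fitz_le T p xs c.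

(** The minorant [L] splits into its restriction [ys] to the first factor and, by reflexivity,
    evaluation at some [y] on the second. Since graph points lie in [N],
    [ys (s + t) + (ss - ts) y <= ss s + ts t]. *)
Lemma fitz_separation : exists y ys, is_dual ys /\
  forall s ss t ts, S s ss -> T t ts ->
    (ss y + ys s - ss s) + (ts (- y) + ys t - ts t) <= 0.
Proof.
pose V : lmodType R := (E * dual R E)%type.
pose d (w : V) := `|w.1| + dual_norm (dual_fun _ _ w.2).
pose N := [set p : V * R | exists x xs r y ys q,
  [/\ fitz_conj_le S x xs r, fitz_conj_le T y ys q,
      p.1.1 = x + y, dual_fun _ _ p.1.2 = (fun e => -1 * ys e + xs e) &
      p.2 = r + q]].
have NG s ss t ts (Ss : S s ss) (Tt : T t ts) :
    N ((s + t, to_dual _ _ _ (is_dual_lin ts ss (-1) (dT _ _ Tt) (dS _ _ Ss))),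
       ss s + ts t).
  exists s, ss, (ss s), t, ts, (ts t); split=> //.
  - by apply: fitz_conj_le_graph => //; exact: dS Ss.
  - by apply: fitz_conj_le_graph => //; exact: dT Tt.
have [s0 [ss0 Ss0]] := S0; have [t0 [ts0 Tt0]] := T0.
have := NG _ _ _ _ Ss0 Tt0; set w0 := (_, to_dual _ _ _ _) => Nw0.
have [K K0 HK] := fitz_sum_lower_bound _ _ dS mS dT mT _ dws domS domT (d w0 + 1).
have [||||L [lL LN [C LC]]] := convex_minorant d N w0 _ K _ _ _ Nw0 K0.
- move=> [x f] [y g]; rewrite /d /=.
  have := dual_norm_lin _ _ 1 (dual_funP _ _ f) (dual_funP _ _ g).
  have -> : (fun e => 1 * dual_fun _ _ f e + dual_fun _ _ g e) = dual_fun _ _ (f + g).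
    by apply/funext => e; rewrite mul1r.
  by have := ler_normD x y; rewrite normr1; lra.
- move=> a [x f]; rewrite /d /= normrZ mulrDr; congr (_ + _).
  (* Homogeneity follows from this inequality applied with [a] and with its inverse. *)
  have le_Z b g : dual_norm (dual_fun _ _ (b *: g)) <= `|b| * dual_norm (dual_fun R E g).
    have := dual_norm_lin _ _ b (dual_funP _ _ g) (@is_dual_zero R E).
    have -> : dual_norm (fun _ : E => 0 : R) = 0.
      apply/eqP; rewrite eq_le dual_norm_ge0 ?andbT; last exact: is_dual_zero.
      by apply: dual_norm_le => e _; rewrite normr0.
    by rewrite addr0; under eq_fun do rewrite addr0.
  apply/eqP; rewrite eq_le le_Z/=; have [->|a0] := eqVneq a 0.
    by rewrite normr0 mul0r; apply: dual_norm_ge0; exact: dual_funP.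
  have := le_Z a^-1 (a *: f); rewrite scalerA mulVf// scale1r normfV.
  by rewrite ler_pdivlMl// normr_gt0.
- move=> a b v w r q a0 b0 ab [x [xs [r1 [y [ys [r2 [Sx Ty v1 v2 /= ->]]]]]]].
  move=> [z [zs [q1 [u [us [q2 [Sz Tu w1 w2 /= ->]]]]]]].
  do 6 eexists; split.
  + exact: fitz_conj_le_convex a0 b0 ab Sx Sz.
  + exact: fitz_conj_le_convex a0 b0 ab Ty Tu.
  + by rewrite /= v1 w1 !scalerDr addrACA.
  + by rewrite /= dual_funD !dual_funZ v2 w2; apply/funext => e; ring.
  + by rewrite /=; ring.
- move=> v r [x [xs [r1 [y [ys [r2 [Sx Ty v1 v2 /= ->]]]]]]].
  by rewrite /d v1 v2; exact: HK.
have L0 : L 0 = 0 by have := lL 1 0 0; rewrite scale1r mul1r addr0; lra.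
have d0 (x : E) : d (x, 0) = `|x|.
  rewrite /d /= [X in _ + X](_ : _ = 0) ?addr0//.
  apply/eqP; rewrite eq_le dual_norm_ge0 ?andbT; last exact: dual_funP.
  by apply: dual_norm_le => e _; rewrite normr0.
pose ys (x : E) : R := L (x, 0).
have dys : is_dual ys.
  apply: (bounded_is_dual _ C) => [a x z|x]; last by rewrite -d0; exact: LC.
  rewrite /ys -lL; congr (L _); apply: injective_projections => /=.
  - by [].
  - by rewrite scaler0 addr0.
have [||y Ly] := bounded_functional_dual (fun f => L (0, f)) C.
- move=> a f g; rewrite -lL; congr (L _); apply: injective_projections => /=.
  + by rewrite scaler0 addr0.
  + by [].
- by move=> f; apply: le_trans (LC _) _; rewrite /d /= normr0 add0r.
exists y, ys; split=> // s ss t ts Ss Tt; have := LN _ _ (NG _ _ _ _ Ss Tt).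
set f := to_dual _ _ _ _.
have -> : L (s + t, f) = ys (s + t) + dual_fun _ _ f y.
  rewrite -Ly /ys -[L (s + t, 0)]mul1r -lL scale1r; congr (L _); apply: injective_projections => /=.
    by rewrite addr0.
  by rewrite add0r.
rewrite to_dualK (is_dualD ys)// (is_dualN ts) ?mulN1r; last exact: dT Tt.
by lra.
Qed.

End Separation.

(** * Meeting points of the graphs, and surjectivity *)

Lemma maximal_monotone_meet (R : realType) (E : completeNormedModType R)
    (S : E -> set (E -> R)) (T : (E -> R) -> set E) (ws : E -> R) :
  reflexive_space E -> maximally_monotone_S S -> maximally_monotone_T T ->
  is_dual ws -> (forall x, exists c, fitz_le S x ws c) ->
  (forall xs, is_dual xs -> exists p c, fitz_le (fun t ts => T ts t) p xs c) ->
  exists y ys, S y ys /\ T ys (- y).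
Proof.
move=> reflE [dS [mS maxS]] [dT [mT maxT]] dws domS domT.
(* An empty graph is not maximal: the zero pair is vacuously monotonically related to it. *)
have T0 : exists t ts, T ts t.
  apply: contrapT => nT; apply: (nT); exists 0, (fun=> 0).
  apply: maxT => [|ts t Tt]; first exact: is_dual_zero.
  by exfalso; apply: nT; exists t, ts.
have S0 : exists s ss, S s ss.
  apply: contrapT => nS; apply: (nS); exists 0, (fun=> 0).
  apply: maxS => [|s ss Ss]; first exact: is_dual_zero.
  by exfalso; apply: nS; exists s, ss.
have [y [ys [dys sep]]] := fitz_separation reflE S (fun t ts => T ts t)
  dS mS (fun t ts => dT ts t) (fun x1 xs1 x2 xs2 => mT xs1 x1 xs2 x2)
  S0 T0 ws dws domS domT.
(* By [sep], the monotonicity expressions at [(y, ys)] for [S] and at [(ys, - y)] for [T] have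
   nonnegative sum. If one for [S] is negative, all those for [T] are positive, so [(ys, - y)] is in
   [T], where its own expression is 0. *)
have Sy : S y ys.
  apply: maxS => // s ss Ss; rewrite leNgt; apply/negP => lt0.
  have dss := dS _ _ Ss.
  have gap ts t : T ts t -> 0 < ys (- y - t) - ts (- y - t).
    move=> Tt; have := sep _ _ _ _ Ss Tt; have dts := dT _ _ Tt.
    move: lt0; rewrite (is_dualB ys)// (is_dualB ss)//.
    by rewrite (is_dualB ys)// (is_dualB ts)// (is_dualN ys)//; lra.
  have Ty : T ys (- y) by apply: maxT => // ts t /gap/ltW.
  by have := gap _ _ Ty; rewrite subrr ltxx.
exists y, ys; split=> //; apply: maxT => // ts t Tt.
have := sep _ _ _ _ Sy Tt; have dts := dT _ _ Tt.
by rewrite (is_dualB ys)// (is_dualB ts)// (is_dualN ys)//; lra.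
Qed.

Lemma fitz_S_fin_num {R : realType} {E : normedModType R}
    (S : E -> set (E -> R)) (x : E) (xs : E -> R) :
  fitz_S S x xs \is a fin_num -> fitz_le S x xs (fine (fitz_S S x xs)).
Proof.
move=> fS s ss Ss; rewrite -lee_fin fineK//.
by apply: ereal_sup_ubound; exists s, ss.
Qed.

Lemma fitz_T_fin_num {R : realType} {E : normedModType R}
    (T : (E -> R) -> set E) (xs : E -> R) (x : E) :
  fitz_T T xs x \is a fin_num ->
  fitz_le (fun t ts => T ts t) x xs (fine (fitz_T T xs x)).
Proof.
move=> fT t ts Tt; rewrite -lee_fin fineK//.
by apply: ereal_sup_ubound; exists ts, t.
Qed.

Theorem theorem7p5 (R : realType) (E : completeNormedModType R)
    (S : E -> set (E -> R)) (T : (E -> R) -> set E) :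
  (exists x : E, x != 0) ->
  reflexive_space E ->
  maximally_monotone_S S ->
  maximally_monotone_T T ->
  (* pi_1 dom phi_T = E^dual *)
  (forall xs : E -> R, is_dual xs -> exists x : E, fitz_T T xs x \is a fin_num) ->
  (* E x {w^dual} subset dom phi_S *)
  (exists ws : E -> R, is_dual ws /\ forall x : E, fitz_S S x ws \is a fin_num) ->
  (* (a) (I_E + TS)(E) = E *)
  (forall z : E, exists x : E, exists ys : E -> R, exists t : E,
      S x ys /\ T ys t /\ z = x + t) /\
  (* (b) (I_{E^dual} + ST)(E^dual) = E^dual *)
  (forall zs : E -> R, is_dual zs -> exists xs : E -> R, exists y : E, exists ss : E -> R,
      is_dual xs /\ T xs y /\ S y ss /\ zs = (fun e => xs e + ss e)).
Proof.
move=> _ reflE maxS [dT [mT maxT]] domT [ws [dws domS]].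
have {}domS x : exists c, fitz_le S x ws c.
  by exists (fine (fitz_S S x ws)); exact: fitz_S_fin_num.
have {}domT xs : is_dual xs -> exists p c, fitz_le (fun t ts => T ts t) p xs c.
  move=> /domT[p pT]; exists p, (fine (fitz_T T xs p)); exact: fitz_T_fin_num.
split=> [z|zs dzs].
  (* For (a), [T] is translated by [- z]: a meeting point has [- y + z] in [T ys]. *)
  have [||y [ys [Sy Ty]]] := maximal_monotone_meet R E S
      (fun ts => [set t | T ts (t + z)]) ws reflE maxS _ dws domS.
  - split=> [ts t /dT//|]; split=> [ts1 t1 ts2 t2 T1 T2|xs x dxs mx].
      have -> : t1 - t2 = t1 + z - (t2 + z) by rewrite opprD addrACA subrr addr0.
      exact: mT.
    apply: maxT => // ts t Tt; have := mx ts (t - z); rewrite /= subrK => /(_ Tt).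
    by rewrite opprB addrA.
  - move=> xs dxs; have [p [c Tpc]] := domT _ dxs.
    exists (p - z), (c - xs z) => t ts Tt; have := Tpc _ _ Tt.
    have dts := dT _ _ Tt.
    by rewrite (is_dualB ts)// (is_dualD xs)// (is_dualD ts)//; lra.
  by exists y, ys, (- y + z); rewrite addrA subrr add0r.
pose refl_zs (ts : E -> R) e := -1 * ts e + zs e.
have drefl ts : is_dual ts -> is_dual (refl_zs ts).
  by move=> dts; exact: is_dual_lin.
have reflK ts : refl_zs (refl_zs ts) = ts.
  by apply/funext => e; rewrite /refl_zs; ring.
(* For (b), [T] is reflected in both variables, which preserves monotonicity: a meeting point has
   [y] in [T (zs - ys)]. *)
have [||y [ys [Sy [dys Ty]]]] := maximal_monotone_meet R E S
    (fun ts => [set t | is_dual ts /\ T (refl_zs ts) (- t)]) ws reflE maxS _ dws domS.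
- split=> [ts t []//|]; split=> [ts1 t1 ts2 t2 [d1 T1] [d2 T2]|xs x dxs mx].
    have := mT _ _ _ _ T1 T2; rewrite -opprD /refl_zs.
    by rewrite (is_dualN zs)// (is_dualN ts1)// (is_dualN ts2)//; lra.
  split=> //; apply: maxT => [|ts t Tt]; first exact: drefl.
  have dts := dT _ _ Tt; have := mx (refl_zs ts) (- t).
  rewrite /= reflK opprK => /(_ (conj (drefl _ dts) Tt)).
  have -> : - x - t = - (x + t) by rewrite opprD.
  rewrite /refl_zs (is_dualN zs)// (is_dualN ts)// (is_dualN xs)//; lra.
- move=> xs dxs; have [p [c Tpc]] := domT _ (drefl _ dxs).
  exists (- p), (c - zs p) => t ts [dts Tt]; have := Tpc _ _ Tt.
  rewrite /refl_zs (is_dualN zs)// (is_dualN ts)// (is_dualN xs)// (is_dualN ts)//.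
  by lra.
exists (refl_zs ys), y, ys; split; first exact: drefl.
rewrite opprK in Ty; split=> //; split=> //.
by apply/funext => e; rewrite /refl_zs; ring.
Qed.
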